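(* Let $X$ be a real Banach space, let $\partial$ be a subdifferential on $X$ (in the sense defined in the context), let $f:X\to\,]-\infty,+\infty]$ be proper and lower semicontinuous, let $U\subset X$ be open and convex and let $\bar{x}\in U$. Then the following are equivalent: (a) $\sup\,\langle\partial f(y),\bar{x}-y\rangle\le 0$ for every $y\in U$; (b) $f(y+t(\bar{x}-y))\le f(y)$ for every $y\in U$ and every $t\in[0,1]$.
   Context: $X$ is a real Banach space with closed unit ball $B_X$, $X^*$ is its topological dual and $\langle\cdot,\cdot\rangle$ is the duality pairing. All functions $f:X\to\,]-\infty,+\infty]$ considered are lower semicontinuous and proper, i.e. $\operatorname{dom} f:=\{x\in X : f(x)<\infty\}\neq\emptyset$. Inequalities between values of $f$ are understood in $]-\infty,+\infty]$, with $+\infty\le+\infty$. For $\bar{x}\in\operatorname{dom} f$, the subdifferential of convex analysis is $$\partial_{cx} f(\bar{x}):=\{x^*\in X^* : \langle x^*,y-\bar{x}\rangle+f(\bar{x})\le f(y),\ \forall y\in X\},$$ and the Clarke subdifferential is $$\partial_C f(\bar{x}):=\{x^*\in X^* : \langle x^*,d\rangle\le f^{\uparrow}(\bar{x};d),\ \forall d\in X\},$$ where $$f^{\uparrow}(\bar{x};d):=\sup_{\delta>0}\ \limsup_{t\searrow 0,\ x\to_f\bar{x}}\ \inf_{d'\in d+\delta B_X}\frac{f(x+td')-f(x)}{t}$$ and $x\to_f\bar{x}$ means $x\to\bar{x}$ and $f(x)\to f(\bar{x})$. All these sets are empty at points outside $\operatorname{dom} f$. A subdifferential on $X$ is an operator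 $\partial$ that associates to each proper lower semicontinuous function $f:X\to\,]-\infty,+\infty]$ a set-valued mapping $\partial f:X\rightrightarrows X^*$ such that: (i) $\partial_{cx} f(x)\subset\partial f(x)\subset\partial_C f(x)$ for every $x\in X$; (ii) $\partial(f-x^* )(x)=\partial f(x)-x^*$ for all $x\in X$ and $x^*\in X^*$; (iii) (Separation Principle) for any proper lower semicontinuous functions $f,\varphi$ on $X$ with $\varphi$ convex and Lipschitz near $\bar{x}\in\operatorname{dom} f\cap\operatorname{dom}\varphi$, if $f+\varphi$ admits a local minimum at $\bar{x}$, then $0\in\partial f(\bar{x})+\partial\varphi(\bar{x})$. Notation: $\sup\,\langle\partial f(y),d\rangle:=\sup\{\langle y^*,d\rangle : y^*\in\partial f(y)\}$, with $\sup\emptyset=-\infty$. *)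

(* Defs.v *)
From HB Require Import structures.
From mathcomp Require Import all_boot all_order all_algebra.
From mathcomp Require Import all_classical all_reals all_analysis.
Set Implicit Arguments.
Unset Strict Implicit.
Unset Printing Implicit Defensive.
Import Order.TTheory GRing.Theory Num.Theory.
Import numFieldNormedType.Exports.
Local Open Scope classical_set_scope.
Local Open Scope ring_scope.
Local Open Scope ereal_scope.

Section Subdifferential.
Context {R : realType} {X : completeNormedModType R}.
Implicit Types (f phi : X -> \bar R) (x d : X) (p q : X -> R^o).

Definition edom f : set X := [set x | f x < +oo].

(* The first clause restricts the values to ]-oo, +oo]. *)
Definition proper_fun f := (forall x, -oo < f x) /\ edom f !=set0.

(* The topological dual X^*, as a set of functions. *)
Definition topdual : set (X -> R^o) := [set p | linear p /\ continuous p].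

Definition subdiff_cx f x : set (X -> R^o) :=
  [set p | [/\ topdual p, edom f x & forall y, (p (y - x)%R)%:E + f x <= f y]].

(* The filter of x ->_f xbar, i.e., x -> xbar and f x -> f xbar. *)
Definition fnbhs f x : set_system X :=
  filter_from (nbhs (x, f x)) (fun V => [set y | V (y, f y)]).

Definition clarke_dd f x d : \bar R :=
  ereal_sup [set
    limf_esup
      (fun ty : R * X => ereal_inf [set
         (f (ty.2 + ty.1 *: d')%R - f ty.2) * (ty.1^-1)%:E
         | d' in [set d' : X | (`|d' - d| <= delta)%R]])
      (filter_prod (0%R)^'+ (fnbhs f x))
    | delta in [set delta : R | (0 < delta)%R]].

Definition subdiff_clarke f x : set (X -> R^o) :=
  [set p | [/\ topdual p, edom f x & forall d, (p d)%:E <= clarke_dd f x d]].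

(* The library's convex_function only covers real-valued functions. *)
Definition econvex phi := forall (x y : X) (t : R), (0 <= t <= 1)%R ->
  phi (t *: x + (1 - t) *: y)%R <= t%:E * phi x + (1 - t)%:E * phi y.

Definition lipschitz_near phi x := exists2 A : set X, nbhs x A &
  (forall y, A y -> phi y \is a fin_num) /\
  [lipschitz (fine (phi y) : R^o) | y in A].

Definition local_min f x := \forall y \near x, f x <= f y.

(* Only the values of D at proper lower semicontinuous functions matter; there
   subdiff_bounds makes them subsets of the dual. *)
Record is_subdifferential (D : (X -> \bar R) -> X -> set (X -> R^o)) : Prop := {
  subdiff_bounds : forall f x, proper_fun f -> lower_semicontinuous f ->
    subdiff_cx f x `<=` D f x /\ D f x `<=` subdiff_clarke f x ;
  subdiff_translation : forall f x p, proper_fun f -> lower_semicontinuous f ->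
    topdual p ->
    D (fun y => f y - (p y)%:E) x = [set (q \- p)%R | q in D f x] ;
  subdiff_separation : forall f phi x,
    proper_fun f -> lower_semicontinuous f ->
    proper_fun phi -> lower_semicontinuous phi ->
    edom f x -> edom phi x ->
    econvex phi -> lipschitz_near phi x ->
    local_min (f \+ phi) x ->
    exists p q, [/\ D f x p, D phi x q & (p \+ q)%R = cst 0%R]
}.

End Subdifferential.

(* Main.v *)
(** (b) => (a): for x near y the direction xbar - x is close to xbar - y and f
   does not increase along it, so the Clarke derivative is nonpositive.

   (a) => (b): suppose f a < f b with b in ]a, xbar], and let C = [a, b].
   Ekeland's principle, applied from a to
   f + alpha |. - xbar| + K dist(., C), yields x near C minimizing f + phi
   locally, where phi = alpha |. - xbar| + K dist(., C) + (alpha/2) |. - x|.  For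
   alpha small, f x stays below f near b, so x is away from b; for K large, x
   is close to C.  Hence a small step from x toward xbar does not increase
   dist(., C), and phi decreases along it.  The separation principle gives p in
   D f x with -p a subgradient of phi, so <p, xbar - x> > 0.  Taking the
   norm |. - xbar| instead of a linear functional avoids the Hahn-Banach
   theorem. *)

Require Import Defs.
From HB Require Import structures.
From mathcomp Require Import all_boot all_order all_algebra.
From mathcomp Require Import all_classical all_reals all_analysis.
From mathcomp Require Import lra.
Import Order.TTheory GRing.Theory Num.Theory.
Import numFieldNormedType.Exports.
Local Open Scope classical_set_scope.
Local Open Scope ring_scope.
Local Open Scope ereal_scope.

Lemma EFin_lt_between (R : realType) (r : R) (z : \bar R) :
  r%:E < z -> exists2 a : R, (r < a)%R & a%:E < z.
Proof.
case: z => [z| |//]; last by exists (r + 1)%R; rewrite ?ltrDl ?ltry.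
by rewrite lte_fin => rz; exists ((r + z) / 2)%R; rewrite ?lte_fin; lra.
Qed.

(** * Ekeland's variational principle *)

Section Ekeland.
Context {R : realType} {X : completeNormedModType R}.
Variables (g : X -> \bar R) (M e : R).
Hypotheses (lscg : lower_semicontinuous g) (gM : forall x, M%:E <= g x).
Hypothesis e_gt0 : (0 < e)%R.

(** Ekeland's preorder; the principle asks for a point whose only successor is itself. *)
Let S (x y : X) := g y + (e * `|y - x|)%:E <= g x.

Let S_refl x : S x x.
Proof. by rewrite /S subrr normr0 mulr0 adde0. Qed.

Let S_le x y : S x y -> g y <= g x.
Proof.
by apply: le_trans; rewrite leeDl// lee_fin mulr_ge0// ltW.
Qed.

Let S_trans x y z : S x y -> S y z -> S x z.
Proof.
move=> Sxy Syz; apply: le_trans Sxy.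
apply: le_trans (leeD2r _ Syz).
rewrite -addeA leeD2l// -EFinD lee_fin -mulrDr ler_pM2l//.
by rewrite (le_trans _ (ler_normD _ _))// addrA subrK.
Qed.

Let g_fin x : g x < +oo -> exists r : R, g x = r%:E.
Proof. by move: (gM x); case: (g x) => // r _ _; exists r. Qed.

(** If [x] were no successor of [w], lower semicontinuity would keep [g] near [x] above some
    [a > v - e * |x - w|], and then [u n] close to [x] could not be a successor either. *)
Let S_closed w (u : nat -> X) x : g w < +oo -> (u n @[n --> \oo] --> x) ->
  (\forall n \near \oo, S w (u n)) -> S w x.
Proof.
move=> /g_fin[v gw] ux Su; rewrite /S leNgt gw; apply/negP => vx.
have : (v - e * `|x - w|)%:E < g x by rewrite EFinB lteBlDr.
case/EFin_lt_between => a va /lscg[V xV Va].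
have [n] : exists n, [/\ V (u n), S w (u n) & (e * `|x - u n| < a - (v - e * `|x - w|))%R].
  apply: (@filter_ex _ (\oo)); near=> n; split; near: n; [exact: ux| exact: Su|].
  move/cvgrPdist_lt : ux => /(_ ((a - (v - e * `|x - w|)) / e)%R).
  rewrite divr_gt0 ?subr_gt0// => /(_ erefl).
  by apply: filterS => n; rewrite ltr_pdivlMr// mulrC.
case=> /Va agu; rewrite /S gw => Sun xu.
have : (a + e * `|u n - w|)%:E < v%:E.
  by apply: lt_le_trans Sun; rewrite EFinD lte_leD.
rewrite lte_fin.
have : (e * `|x - w| <= e * `|x - u n| + e * `|u n - w|)%R.
  rewrite -mulrDr ler_pM2l//.
  by rewrite (le_trans _ (ler_normD _ _))// addrA subrK.
lra.
Unshelve. all: by end_near. Qed.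

(** An almost minimizer of [g] among the successors of [x]. The condition [g x < +oo] stands under
    the existential so that [choice] yields a total function. *)
Let step (n : nat) x : exists y, g x < +oo ->
  S x y /\ forall z, S x z -> g y <= g z + (n.+1%:R^-1)%:E.
Proof.
have [gx|] := boolP (g x < +oo); last by exists x.
have [| |_ [y Sxy <-] yinf] := @lb_ereal_inf_adherent R (g @` [set y | S x y])
    (n.+1%:R^-1)%R; first by rewrite invr_gt0.
- have [r gxr] := g_fin _ gx.
  rewrite fin_numE -ltNye -ltey; apply/andP; split.
    by apply: (@lt_le_trans _ _ M%:E); rewrite ?ltNyr// le_ereal_inf_tmp// => _ [y _ <-].
  by apply: le_lt_trans gx; apply: ereal_inf_lbound; exists x => //; exact: S_refl.
exists y => _; split=> // z Sxz; apply/ltW; apply: lt_le_trans yinf _.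
by rewrite leeD2r// ereal_inf_lbound//; exists z.
Qed.

(** Iterating [step] from [a], the successors of [u n.+1] have values within [1/(n+1)] of
    [g (u n.+1)], hence lie within [1/(e(n+1))] of it. So [u] is Cauchy, and its limit succeeds
    every [u n]. *)
Lemma ekeland a : g a < +oo ->
  exists x, g x + (e * `|x - a|)%:E <= g a /\
    forall y, g x <= g y + (e * `|y - x|)%:E.
Proof.
move=> ga.
have [nx nxP] := choice (fun p : nat * X => step p.1 p.2).
pose u := fix u n := if n is m.+1 then nx (m, u m) else a.
have gu n : g (u n) < +oo.
  by elim: n => // n IH; have [/S_le + _] := nxP (n, u n) IH; move/le_lt_trans; exact.
have uS n : S (u n) (u n.+1) := (nxP (n, u n) (gu n)).1.
have uinf n z : S (u n) z -> g (u n.+1) <= g z + (n.+1%:R^-1)%:E.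
  exact: (nxP (n, u n) (gu n)).2.
have uSS n m : (n <= m)%N -> S (u n) (u m).
  elim: m => [|m IH]; first by rewrite leqn0 => /eqP ->.
  rewrite leq_eqVlt => /orP[/eqP <- //|nm].
  exact: S_trans (IH nm) (uS m).
have dist n z : S (u n.+1) z -> (`|z - u n.+1| <= (e * n.+1%:R)^-1)%R.
  move=> Sz; have := uinf n z (S_trans _ _ _ (uS n) Sz).
  have [r gr] := g_fin _ (gu n.+1).
  have [s gs] : exists s, g z = s%:E by apply: g_fin; apply: le_lt_trans (S_le _ _ Sz) (gu _).
  move: Sz; rewrite /S gr gs !lee_fin => h1 h2.
  rewrite invfM ler_pdivlMl//.
  by rewrite -(lerD2l s); exact: le_trans h2.
have dcvg : (((e * n.+1%:R)^-1)%R : R) @[n --> \oo] --> (0%R : R).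
  under eq_fun do rewrite invfM.
  rewrite -(mulr0 (e^-1)%R); apply: cvgM; first exact: cvg_cst.
  exact: cvg_harmonic.
have : cvg (u n @[n --> \oo]).
  apply/cauchy_cvgP; apply/cauchy_exP => eps eps0.
  have := cvgr0_norm_lt _ dcvg _ eps0.
  case=> N _ /(_ N (leqnn N)) NE.
  exists (u N.+1); exists N.+1 => // m /= Nm.
  rewrite -ball_normE /= distrC; apply: le_lt_trans (dist _ _ (uSS _ _ Nm)) _.
  exact: le_lt_trans (ler_norm _) NE.
move=> /cvg_ex[/= x ux].
have Sx n : S (u n) x.
  by apply: S_closed (gu n) ux _; exists n => // m; exact: uSS.
exists x; split; first exact: (Sx 0%N).
(* A violating [y] would succeed [x], hence every [u n], so [u] would also converge to [y]; but
   [y = x] violates nothing. *)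
move=> y; rewrite leNgt; apply/negP => yx.
have Sxy : S x y by apply: ltW.
suff xy : x = y by move: yx; rewrite xy subrr normr0 mulr0 adde0 ltxx.
have uy : u n.+1 @[n --> \oo] --> y.
  apply/cvgrPdist_le => eps eps0.
  apply: filterS (cvgr0_norm_lt _ dcvg _ eps0) => n nE.
  apply: le_trans (dist _ _ (S_trans _ _ _ (Sx n.+1) Sxy)) _.
  exact: le_trans (ler_norm _) (ltW nE).
have ux1 : u n.+1 @[n --> \oo] --> x by rewrite (cvg_shiftS u).
exact: cvg_unique ux1 uy.
Qed.

End Ekeland.

(** * Clarke subgradients and Lipschitz convex functions *)

Section ClarkeConvex.
Context {R : realType} {X : completeNormedModType R}.
Implicit Types (f : X -> \bar R) (phi : X -> R) (C : set X).

(** The upper limit is at most the supremum over any one set of the filter; the set taken is that of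
    all pairs whose infimum is at most [c]. Since [f y] tends to the finite value [f x], it may be
    assumed finite. *)
Lemma clarke_dd_le f x d c : f x \is a fin_num ->
  (forall delta : R, (0 < delta)%R -> exists2 V, nbhs x V &
    forall y t, V y -> f y \is a fin_num -> (0 < t <= 1)%R ->
    exists2 d', (`|d' - d| <= delta)%R &
      (f (y + t *: d')%R - f y) * (t^-1)%:E <= c) ->
  clarke_dd f x d <= c.
Proof.
move=> fx dP; apply: ge_ereal_sup => _ [delta /= d0 <-].
have [V xV VP] := dP delta d0.
pose Q (ty : R * X) := ereal_inf [set (f (ty.2 + ty.1 *: d')%R - f ty.2) *
  (ty.1^-1)%:E | d' in [set d' : X | (`|d' - d| <= delta)%R]] <= c.
apply: ge_ereal_inf; eexists; first (exists [set` Q]; last reflexivity); last first.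
  by apply: ge_ereal_sup => _ [ty Qty <-]; exact: Qty.
exists ([set t | 0 < t <= 1]%R, [set y | V y /\ f y \is a fin_num]) => /=.
  split.
    near=> t; apply/andP; split=> //; near: t; exact: nbhs_right_le.
  exists (V `*` [set z | z \is a fin_num]) => //.
  exists (V, [set z | z \is a fin_num]) => //=; split=> //.
  by rewrite -(fineK fx) /nbhs/= /ereal_nbhs/=; apply: filterE.
move=> [t y] /= [t01 [Vy fy]].
have [d' dd' fc] := VP y t Vy fy t01.
by apply: ge_ereal_inf; exists ((f (y + t *: d')%R - f y) * (t^-1)%:E) => //; exists d'.
Unshelve. all: by end_near. Qed.

(** A class stable under sums and nonnegative multiples that meets all conditions the separation
    principle puts on [phi]. *)
Definition lipschitz_convex phi :=
  (exists L : R, forall x y, `|phi x - phi y| <= L * `|x - y|)%R /\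
  (forall (x y : X) (t : R), 0 <= t <= 1 ->
    phi (t *: x + (1 - t) *: y) <= t * phi x + (1 - t) * phi y)%R.

Lemma lipschitz_convex_norm (z : X) : lipschitz_convex (fun x => `|x - z|)%R.
Proof.
split.
  exists 1%R => x y; rewrite mul1r (le_trans (ler_dist_dist _ _))//.
  by rewrite opprB addrA subrK.
move=> x y t /andP[t0 t1].
have -> : (t *: x + (1 - t) *: y - z = t *: (x - z) + (1 - t) *: (y - z))%R.
  by rewrite !scalerBr addrACA -opprD -scalerDl addrCA subrr addr0 scale1r.
by rewrite (le_trans (ler_normD _ _))// !normrZ !ger0_norm// subr_ge0.
Qed.

Lemma lipschitz_convexD phi psi : lipschitz_convex phi -> lipschitz_convex psi ->
  lipschitz_convex (fun x => phi x + psi x)%R.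
Proof.
move=> [[L phiL] phic] [[L' psiL] psic]; split.
  exists (L + L')%R => x y; rewrite opprD addrACA mulrDl.
  by rewrite (le_trans (ler_normD _ _))// lerD.
move=> x y t t01; rewrite !mulrDr addrACA lerD//; [exact: phic|exact: psic].
Qed.

Lemma lipschitz_convexZ (k : R) phi : (0 <= k)%R -> lipschitz_convex phi ->
  lipschitz_convex (fun x => k * phi x)%R.
Proof.
move=> k0 [[L phiL] phic]; split.
  exists (k * L)%R => x y.
  by rewrite -mulrBr normrM ger0_norm// -mulrA ler_wpM2l.
move=> x y t t01; rewrite !(mulrCA _ k) -mulrDr ler_wpM2l//; exact: phic.
Qed.

Lemma lipschitz_convex_continuous phi : lipschitz_convex phi -> continuous (phi : X -> R^o).
Proof.
move=> [[L phiL] _] x; apply/cvgrPdist_lt => e e0.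
have L1 : (0 < `|L| + 1)%R by rewrite ltr_wpDl.
near=> y; apply: le_lt_trans (phiL _ _) _.
have : (`|x - y| < e / (`|L| + 1))%R.
  by near: y; apply: cvgr_dist_lt; rewrite ?divr_gt0.
rewrite ltr_pdivlMr// => h; apply: le_lt_trans h.
rewrite mulrC ler_wpM2l// (le_trans (ler_norm _))// lerDl//.
Unshelve. all: by end_near. Qed.

(** By convexity the quotient at [y] along [d] with step [t <= 1] is at most [phi (y + d) - phi y],
    which is continuous in [y]. *)
Lemma subdiff_clarke_convex phi x (q : X -> R^o) d : lipschitz_convex phi ->
  subdiff_clarke (EFin \o phi) x q -> (q d <= phi (x + d) - phi x)%R.
Proof.
move=> phiC [_ _ /(_ d) qd]; rewrite -lee_fin.
apply/lee_addgt0Pr => e e0; apply: le_trans qd _.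
have phicont := lipschitz_convex_continuous _ phiC.
apply: clarke_dd_le => // delta d0.
exists [set y | phi (y + d) - phi y < phi (x + d) - phi x + e]%R.
  have : (phi (y + d) - phi y)%R @[y --> x] --> (phi (x + d) - phi x : R^o)%R.
    apply: cvgB; last exact: phicont.
    apply: (cvg_comp (fun y => y + d)%R) (phicont _).
    by apply: cvgD => //; exact: cvg_cst.
  by move/cvgr_lt; apply; rewrite ltrDl.
move=> y t /= yV _ /andP[t0 t1]; exists d; first by rewrite subrr normr0 ltW.
rewrite -EFinB -EFinM -EFinD lee_fin ler_pdivrMr//.
have := phiC.2 (y + d)%R y t; rewrite ltW//= => /(_ t1).
have -> : (t *: (y + d) + (1 - t) *: y = y + t *: d)%R.
  by rewrite scalerDr addrAC -scalerDl addrCA subrr addr0 scale1r.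
nra.
Qed.

Lemma EFin_proper phi : proper_fun (EFin \o phi).
Proof. by split=> [x|]; [rewrite /= ltNyr | exists 0%R; rewrite /edom/= ltry]. Qed.

Lemma lipschitz_convex_lsc phi : lipschitz_convex phi ->
  lower_semicontinuous (EFin \o phi).
Proof.
move=> /lipschitz_convex_continuous phic x a; rewrite /= lte_fin => ax.
exists [set y | a < phi y]%R => //.
exact: (cvgr_gt _ (phic x)).
Qed.

(** Separation gives [p] and [q] with [p + q = 0], where [q] is a Clarke subgradient of [phi], hence
    a convex one. *)
Lemma subdiff_local_min (D : (X -> \bar R) -> X -> set (X -> R^o)) f phi x :
  is_subdifferential D -> proper_fun f -> lower_semicontinuous f ->
  lipschitz_convex phi -> edom f x -> local_min (f \+ (EFin \o phi)) x ->
  exists2 p, D f x p & forall d, (phi x - phi (x + d) <= p d)%R.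
Proof.
move=> DP fproper flsc phiC fx fmin.
have phip := EFin_proper phi.
have phil := lipschitz_convex_lsc _ phiC.
have [|||p [q [Dp Dq pq0]]] :=
  subdiff_separation DP fproper flsc phip phil fx _ _ _ fmin.
- by rewrite /edom /= ltry.
- by move=> y z t t01; rewrite /= -!EFinM -EFinD lee_fin phiC.2.
- exists setT; first exact: filterT.
  split=> //; have [L phiL] := phiC.1.
  exists L; split; first exact: num_real.
  move=> M LM [y z] _ /=; apply: le_trans (phiL _ _) _.
  by rewrite ler_wpM2r// ltW.
exists p => // d.
have := subdiff_clarke_convex _ _ q d phiC ((subdiff_bounds DP x phip phil).2 _ Dq).
have : (p d + q d = 0)%R by have /(congr1 (@^~ d)) := pq0.
lra.
Qed.

(** * Distance to a convex set and lower bounds near a compact set *)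

Definition distance C (x : X) : R := inf [set `|x - u|%R | u in C].

Lemma distance_ge0 C x : (0 <= distance C x)%R.
Proof.
rewrite /distance; have [->|/set0P[u Cu]] := eqVneq C set0.
  by rewrite image_set0 inf0.
by apply: lb_le_inf => [|_ [v _ <-]//]; exists `|x - u|%R, u.
Qed.

Lemma distance_le C x u : C u -> (distance C x <= `|x - u|)%R.
Proof.
move=> Cu; apply: ge_inf; last by exists u.
by exists 0%R => _ [v _ <-].
Qed.

Lemma distance_lt C x r : C !=set0 -> (distance C x < r)%R ->
  exists2 u, C u & (`|x - u| < r)%R.
Proof.
move=> [u0 Cu0] dr.
have [||_ [u Cu <-]] := @inf_adherent R [set `|x - u|%R | u in C] (r - distance C x)%R.
- by rewrite subr_gt0.
- by split; [exists `|x - u0|%R, u0 | exists 0%R => _ [v _ <-]].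
by rewrite -/(distance C x) addrCA subrr addr0; exists u.
Qed.

(** The infimum need not be attained, so both bounds use points of [C] that realize it up to an
    arbitrary [e]. *)
Lemma lipschitz_convex_distance C : C !=set0 ->
  (forall u v (t : R), (0 <= t <= 1)%R -> C u -> C v -> C (t *: u + (1 - t) *: v)%R) ->
  lipschitz_convex (distance C).
Proof.
move=> C0 Cc; split.
  have lip x y : (distance C x - distance C y <= `|x - y|)%R.
    rewrite lerBlDl; apply/ler_addgt0Pr => e e0.
    have [|u Cu yu] := distance_lt C y (distance C y + e)%R C0; first by rewrite ltrDl.
    apply: le_trans (distance_le _ _ _ Cu) _.
    have : (`|x - u| <= `|x - y| + `|y - u|)%R.
      by rewrite (le_trans _ (ler_normD _ _))// addrA subrK.
    lra.
  exists 1%R => x y; rewrite mul1r ler_norml lip andbT.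
  by have := lip y x; rewrite distrC; lra.
move=> x y t /[dup] t01 /andP[t0 t1].
apply/ler_addgt0Pr => e e0.
have [|u Cu xu] := distance_lt C x (distance C x + e)%R C0; first by rewrite ltrDl.
have [|v Cv yv] := distance_lt C y (distance C y + e)%R C0; first by rewrite ltrDl.
apply: le_trans (distance_le _ _ _ (Cc _ _ _ t01 Cu Cv)) _.
have -> : (t *: x + (1 - t) *: y - (t *: u + (1 - t) *: v) =
   t *: (x - u) + (1 - t) *: (y - v))%R by rewrite !scalerBr opprD addrACA.
apply: le_trans (ler_normD _ _) _; rewrite !normrZ (ger0_norm t0).
rewrite ger0_norm ?subr_ge0//; nra.
Qed.

(** Lower semicontinuity gives a bound around each point of [K], and compactness makes it uniform.
    One parameter [n] tending to infinity encodes both the radius [1/n] and the bound [-n]. *)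
Lemma lsc_compact_lower_bound f (U K : set X) :
  (forall x, -oo < f x) -> lower_semicontinuous f -> open U -> compact K ->
  K `<=` U -> exists delta M : R, (0 < delta)%R /\
    forall u x, K u -> (`|x - u| < delta)%R -> U x /\ M%:E <= f x.
Proof.
move=> fNy flsc oU /compact_near_coveringP Kc KU.
have := Kc R (+oo%R : set_system R) (fun n u => forall x, (`|x - u| * n < 1)%R ->
  U x /\ (- n)%:E <= f x) _.
case.
  move=> u Ku.
  have [a au] : exists a, a%:E < f u.
    move: (fNy u); case: (f u) => // [r _|_]; last by exists 0%R; rewrite ltry.
    by exists (r - 1)%R; rewrite lte_fin ltrBlDr ltrDl.
  have [V uV Va] := flsc _ _ au.
  have uU : nbhs u U by apply: open_nbhs_nbhs; split=> //; exact: KU.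
  have /nbhs_ballP[e /= e0 eUV] : nbhs u (U `&` V) by exact: filterI.
  near=> v n => x vx.
  have n0 : (0 < n)%R by near: n; apply: nbhs_pinfty_gt; exact: num_real.
  have ne : (2 < n * e)%R.
    by rewrite -ltr_pdivrMr//; near: n; apply: nbhs_pinfty_gt; exact: num_real.
  have na : (- n <= a)%R.
    by rewrite lerNl; near: n; apply: nbhs_pinfty_ge; exact: num_real.
  have uv : (`|u - v| < e / 2)%R.
    by near: v; apply: cvgr_dist_lt; rewrite ?divr_gt0.
  have xv : (`|x - v| < e / 2)%R by 
    by rewrite -(ltr_pM2r n0) (lt_trans vx)// mulrAC ltr_pdivlMr// mul1r mulrC.
  have : ball u e x.
    rewrite -ball_normE /=; have : (`|u - x| <= `|u - v| + `|x - v|)%R.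
      by rewrite (distrC x) (le_trans _ (ler_normD _ _))// addrA subrK.
    lra.
  case/eUV => Ux /Va ax; split=> //.
  by apply: le_trans (ltW ax); rewrite lee_fin.
move=> N [_ NP]; exists (`|N| + 1)^-1%R, (- (`|N| + 1))%R.
have N1 : (0 < `|N| + 1)%R by rewrite ltr_wpDl.
split; first by rewrite invr_gt0.
move=> u x Ku xu; apply: (NP (`|N| + 1)%R) Ku _ _.
  by rewrite (le_lt_trans (ler_norm _))// ltrDl.
by rewrite -ltr_pdivlMr// mul1r.
Unshelve. all: by end_near. Qed.

End ClarkeConvex.

(** * Existence of a subgradient that is positive toward [z] *)

Section Ascent.
Context {R : realType} {X : completeNormedModType R}.

Lemma topdualZ (p : X -> R^o) (k : R) (d : X) : topdual p -> (p (k *: d) = k * p d)%R.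
Proof.
move=> [pl _]; have p0 : p 0%R = 0%R.
  by have /eqP := pl 1%R 0%R 0%R; rewrite !scale1r addr0 -subr_eq subrr eq_sym => /eqP.
by have := pl k d 0%R; rewrite p0 !addr0.
Qed.

(** With [z] the point xbar, the conclusion contradicts (a). The point b of the overview is
    [g t]. *)
Lemma subdiff_ascent (D : (X -> \bar R) -> X -> set (X -> R^o)) (f : X -> \bar R)
    (U : set X) (a z : X) (t : R) :
  is_subdifferential D -> proper_fun f -> lower_semicontinuous f -> open U ->
  (0 <= t <= 1)%R ->
  (forall s, (0 <= s <= t)%R -> U (a + s *: (z - a))%R) ->
  f a < f (a + t *: (z - a))%R ->
  exists x p, [/\ U x, D f x p & (0 < p (z - x))%R].
Proof.
move=> DP fproper flsc oU /andP[t0 t1] aU fab.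
have [fNy _] := fproper.
pose g s := (a + s *: (z - a))%R.
have gz s : (z - g s = (1 - s) *: (z - a))%R.
  by rewrite /g scalerBl scale1r opprD addrA.
have gg s s' : (g s - g s' = (s - s') *: (z - a))%R.
  by rewrite /g opprD addrACA subrr add0r -scalerBl.
pose l := `|z - a|%R.
have l0 : (0 < l)%R.
  rewrite normr_gt0; apply: contraTneq fab => ->.
  by rewrite scaler0 addr0 ltxx.
have [fa faE] : exists r : R, f a = r%:E.
  by move: fab (fNy a); case: (f a) => [r|+ _|_ //]; [exists r|rewrite ltNge leey].
rewrite faE in fab; have [r far rfb] := EFin_lt_between _ _ _ fab.
have [V bV Vr] := flsc _ _ rfb.
have /nbhs_ballP[rho2 /= rho20 ballV] := bV.
(* Half the radius: if [x] is at least [rho2] away from [g t], any point within [rho] of [x] is more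
   than [rho] away from [g t]. *)
pose rho := (rho2 / 2)%R.
have rho0 : (0 < rho)%R by rewrite divr_gt0.
pose C := [set g s | s in [set s | 0 <= s <= t]%R].
have Ca : C a by exists 0%R; rewrite /= ?lexx// /g scale0r addr0.
have C0 : C !=set0 by exists a.
have Ccvx u v (k : R) : (0 <= k <= 1)%R -> C u -> C v ->
    C (k *: u + (1 - k) *: v)%R.
  move=> /andP[k0 k1] [s /= /andP[s0 st] <-] [s' /= /andP[s'0 s't] <-].
  exists (k * s + (1 - k) * s')%R.
    by apply/andP; split; nra.
  rewrite /g; move: (z - a)%R => w; rewrite !scalerDr (addrACA (k *: a)%R).
  by rewrite -scalerDl (addrC k) subrK scale1r !scalerA -scalerDl.
have CU : C `<=` U by move=> _ [s /= st <-]; exact: aU.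
have Ccompact : compact C.
  have -> : C = g @` `[0%R, t]%classic.
    by congr image; apply/seteqP; split=> s /=; rewrite in_itv.
  apply: continuous_compact; last exact: segment_compact.
  apply: continuous_subspaceT => s; apply: cvgD; first exact: cvg_cst.
  by apply: cvgZl.
have [delta [M [delta0 CM]]] := lsc_compact_lower_bound _ _ _ fNy flsc oU Ccompact CU.
have Mfa : (M <= fa)%R.
  by have := CM a a Ca; rewrite subrr normr0 faE lee_fin => /(_ delta0)[].
(* Chosen so that the starting value [h a = fa + alpha * l] is midway between [fa] and [r]. *)
pose alpha := ((r - fa) / (2 * l))%R.
have alpha0 : (0 < alpha)%R by rewrite divr_gt0 ?subr_gt0// mulr_gt0.
have alphal : (fa + alpha * l < r)%R.
  have -> : (alpha * l = (r - fa) / 2)%R.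
    by rewrite /alpha invfM mulrA mulfVK// gt_eqF.
  lra.
(* Within [delta] of [C] the bound [M] and membership in [U] hold; [rho] serves to keep away from
   [g t]. *)
pose eta := Num.min delta rho.
have eta0 : (0 < eta)%R by rewrite lt_min delta0.
(* [K] is so large that approximate minimizers are [eta]-close to [C]. *)
pose K := ((fa + alpha * l - M + 1) / eta)%R.
have K1 : (0 < fa + alpha * l - M + 1)%R.
  by have := mulr_gt0 alpha0 l0; lra.
have K0 : (0 < K)%R by rewrite divr_gt0.
have Keta : (K * eta = fa + alpha * l - M + 1)%R by rewrite mulfVK// gt_eqF.
pose phi0 x := (alpha * `|x - z| + K * distance C x)%R.
have phi0C : lipschitz_convex phi0.
  apply: lipschitz_convexD; apply: lipschitz_convexZ; rewrite ?ltW//.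
    exact: lipschitz_convex_norm.
  exact: lipschitz_convex_distance.
have dCa : distance C a = 0%R.
  apply/le_anti; rewrite distance_ge0 andbT.
  by have := distance_le _ a a Ca; rewrite subrr normr0.
(* [f] is truncated at [M] because Ekeland's principle needs a function that is
   bounded below everywhere. *)
pose h x := maxe (f x) M%:E + (phi0 x)%:E.
have ha : h a = (fa + alpha * l)%:E.
  by rewrite /h /phi0 dCa mulr0 addr0 faE max_l ?lee_fin// distrC.
have phi0_ge0 x : (0 <= phi0 x)%R.
  by rewrite addr_ge0// mulr_ge0 ?distance_ge0// ltW.
have hM x : M%:E <= h x.
  apply: (@le_trans _ _ (maxe (f x) M%:E)); first by rewrite le_max lexx orbT.
  by rewrite leeDl// lee_fin.
have hlsc : lower_semicontinuous h.
  move=> x c; rewrite /h -lteBlDr// -EFinB => /EFin_lt_between[c' cc' c'f].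
  have [W xW Wc'] : exists2 W, nbhs x W & forall y, W y -> c'%:E < maxe (f y) M%:E.
    move: c'f; rewrite lt_max => /orP[/flsc[W xW Wf]|c'M].
      by exists W => // y /Wf; rewrite lt_max => ->.
    by exists setT => [|y _]; [exact: filterT|rewrite lt_max c'M orbT].
  exists (W `&` [set y | c - c' < phi0 y]%R).
    apply: filterI => //.
    apply: (cvgr_gt _ (lipschitz_convex_continuous _ phi0C x)); lra.
  move=> y [/Wc' Wy /= cphi].
  rewrite -(subrK c' c) addrC EFinD; apply: lteD => //.
(* The slope is half of [alpha], so that moving toward [z] gains more through [alpha * |. - z|] than
   the Ekeland term costs. *)
have [| |x [xa xmin]] := ekeland h M (alpha / 2) hlsc hM _ a.
- by rewrite divr_gt0.
- by rewrite ha ltry.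
have hxa : h x <= (fa + alpha * l)%:E.
  by rewrite -ha; apply: le_trans xa; rewrite leeDl// lee_fin mulr_ge0// ltW// divr_gt0.
have dx : (distance C x < eta)%R.
  rewrite -(ltr_pM2l K0) Keta.
  have : (M + phi0 x)%:E <= (fa + alpha * l)%:E.
    by apply: le_trans hxa; rewrite EFinD /h leeD2r// le_max lexx orbT.
  rewrite lee_fin /phi0; have : (0 <= alpha * `|x - z|)%R by rewrite mulr_ge0// ltW.
  lra.
have fxa : f x <= (fa + alpha * l)%:E.
  apply: le_trans hxa; apply: (@le_trans _ _ (maxe (f x) M%:E)).
    by rewrite le_max lexx.
  by rewrite leeDl// lee_fin.
have xb : (rho2 <= `|g t - x|)%R.
  rewrite leNgt; apply/negP => xb; have /ballV/Vr : ball (g t) rho2 x by rewrite -ball_normE.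
  by rewrite ltNge (le_trans fxa)// lee_fin ltW.
have near_far s : (0 <= s <= t)%R -> (`|x - g s| < rho)%R -> (rho < (t - s) * l)%R.
  move=> /andP[s0 st] xs.
  have : (`|g t - x| <= `|g t - g s| + `|x - g s|)%R.
    by rewrite (distrC x) (le_trans _ (ler_normD _ _))// addrA subrK.
  rewrite gg normrZ ger0_norm ?subr_ge0// -/l.
  have : (rho2 = rho + rho)%R by rewrite /rho -splitr.
  lra.
have [u [su /= sut suE] xu] := distance_lt _ _ _ C0 dx.
have xurho : (`|x - u| < rho)%R by rewrite (lt_le_trans xu)// ge_min lexx orbT.
have xudelta : (`|x - u| < delta)%R by rewrite (lt_le_trans xu)// ge_min lexx.
have Cu : C u by exists su.
(* If [x = z], then [(1 - su) * l = |x - u| < rho < (t - su) * l], against [t <= 1]. *)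
have xz : (0 < `|z - x|)%R.
  rewrite normr_gt0 subr_eq0; apply/eqP => zx.
  have := near_far su sut; rewrite suE => /(_ xurho).
  move: xurho; rewrite -zx -suE gz normrZ -/l ger0_norm; last by case/andP: sut; lra.
  nra.
have [Ux _] := CM _ _ Cu xudelta.
pose phi y := (phi0 y + alpha / 2 * `|y - x|)%R.
have phiC : lipschitz_convex phi.
  apply: lipschitz_convexD => //; apply: lipschitz_convexZ.
    by rewrite ltW// divr_gt0.
  exact: lipschitz_convex_norm.
have fx : edom f x by apply: le_lt_trans fxa _; rewrite ltry.
have [|p Dp pphi] := subdiff_local_min _ _ _ _ DP fproper flsc phiC fx.
  (* Near [x] the truncation at [M] is inactive, so Ekeland's inequality says that [f + phi] has a
     local minimum at [x]. *)
  have : \forall y \near x, (`|y - u| < delta)%R.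
    near=> y.
    have xy : (`|x - y| < delta - `|x - u|)%R.
      by near: y; apply: cvgr_dist_lt; rewrite ?subr_gt0.
    have : (`|y - u| <= `|x - y| + `|x - u|)%R.
      by rewrite (distrC x y) (le_trans _ (ler_normD _ _))// addrA subrK.
    lra.
  apply: filterS => y yu; have [_ My] := CM _ _ Cu yu.
  have [_ Mx] := CM _ _ Cu xudelta.
  have := xmin y; rewrite /h (max_l My) (max_l Mx) /phi /= subrr normr0 mulr0 addr0.
  by rewrite -addeA -EFinD.
exists x, p; split=> //.
have [_ pclarke] := subdiff_bounds DP x fproper flsc.
have [pdual _ _] := pclarke _ Dp.
(* The points of [C] that nearly realize the distance to [x] stay away from
   [g t], so a proportion [mu] of the way from them to [z] remains in [C]. *)
pose mu := (rho / l)%R.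
have mu0 : (0 < mu)%R by rewrite divr_gt0.
have mut s : (0 <= s <= t)%R -> (`|x - g s| < rho)%R -> (mu < t - s)%R.
  by move=> st xs; rewrite ltr_pdivrMr// near_far.
have mu1 : (mu < 1)%R.
  have := mut su sut; rewrite suE => /(_ xurho); case/andP: sut; lra.
(* It suffices that [phi] drops from [x] to [x + mu *: (z - x)]: the first term loses
   [alpha * mu * |z - x|], the last gains half of that, and the distance does not grow. *)
rewrite -(pmulr_rgt0 _ mu0) -topdualZ//; apply: lt_le_trans (pphi _).
rewrite subr_gt0 /phi /phi0 subrr normr0 mulr0 addr0.
have -> : (x + mu *: (z - x) - x = mu *: (z - x))%R by rewrite addrC addKr.
have -> : (x + mu *: (z - x) - z = (1 - mu) *: (x - z))%R.
  by rewrite scalerBl scale1r -(opprB x z) scalerN addrAC.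
clearbody mu; have mu1' : (0 < 1 - mu)%R by rewrite subr_gt0.
rewrite !normrZ (gtr0_norm mu0) (gtr0_norm mu1') (distrC x z).
(* The homothety of center [z] and ratio [1 - mu] sends [x] to the new point and [g s] to
   [g (s + mu * (1 - s))], which is in [C] because [mu * (1 - s) <= mu < t - s]. *)
have : (distance C (x + mu *: (z - x)) <= distance C x)%R.
  apply/ler_addgt0Pr => e e0.
  have [|v [s /= st sv] xv] := distance_lt _ x (Num.min eta (distance C x + e))%R C0.
    by rewrite lt_min dx ltrDl.
  rewrite -sv lt_min in xv; case/andP: xv => xeta xe.
  have := mut s st (lt_le_trans xeta _); rewrite ge_min lexx orbT => /(_ erefl) mus.
  apply: le_trans (ltW xe); apply: (@le_trans _ _ `|(1 - mu) *: (x - g s)|%R).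
    have -> : ((1 - mu) *: (x - g s) =
        x + mu *: (z - x) - g (s + mu * (1 - s)))%R.
      have -> : (g (s + mu * (1 - s)) = g s + mu *: (z - g s))%R.
        by rewrite gz scalerA /g scalerDl addrA.
      move: (g s) => y; rewrite opprD addrACA scalerBl scale1r; congr (_ + _)%R.
      rewrite -scalerBr -scalerN opprB; congr (_ *: _)%R.
      by rewrite (opprB z) [RHS]addrC addrA subrK.
    apply: distance_le; exists (s + mu * (1 - s))%R => //=; case/andP: st => s0 st.
    apply/andP; split; nra.
  rewrite normrZ (gtr0_norm mu1').
  by rewrite ler_piMl//; lra.
rewrite -(ler_pM2l K0) => Kd.
have : (0 < alpha * (mu * `|z - x|))%R by do 2 apply: mulr_gt0 => //.
nra.
Unshelve. all: by end_near. Qed.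

End Ascent.

(** * The equivalence of (a) and (b) *)

Theorem theorem2p1 (R : realType) (X : completeNormedModType R)
    (D : (X -> \bar R) -> X -> set (X -> R^o)) (f : X -> \bar R)
    (U : set X) (xbar : X) :
  is_subdifferential D ->
  proper_fun f -> lower_semicontinuous f ->
  open U -> convex_set (U : set (convex_lmodType X)) -> U xbar ->
  (forall y, U y -> ereal_sup [set (p (xbar - y)%R)%:E | p in D f y] <= 0)
  <->
  (forall (y : X) (t : R), U y -> (0 <= t <= 1)%R ->
     f (y + t *: (xbar - y))%R <= f y).
Proof.
move=> DP fproper flsc oU cU Ux; split=> [supD y t Uy t01|fmono y Uy].
  rewrite leNgt; apply/negP => fy.
  have [|x [p [Uxx Dp]]] := subdiff_ascent _ _ U _ _ _ DP fproper flsc oU t01 _ fy.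
    move=> s /andP[s0 st].
    have s1 : (0 <= s <= 1)%R by rewrite s0 (le_trans st)//; case/andP: t01.
    have [k ks] : exists k : {i01 R}, k%:num%R = s.
      by exists (Itv01 s0 (andP s1).2).
    have := cU xbar y k (mem_set Ux) (mem_set Uy).
    have -> : (y + s *: (xbar - y) = s *: xbar + (1 - s) *: y)%R.
      by rewrite scalerBr scalerBl scale1r addrCA.
    by rewrite inE -ks.
  apply/negP; rewrite -leNgt -lee_fin; apply: le_trans (supD x Uxx).
  by apply: ereal_sup_ubound; exists p.
apply: ge_ereal_sup => _ [p Dp <-].
have [_ fy pclarke] := (subdiff_bounds DP y fproper flsc).2 _ Dp.
apply: le_trans (pclarke _) _; apply: clarke_dd_le.
  by rewrite fin_numE -ltNye fproper.1 -ltey.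
(* The direction [xbar - x] differs from [xbar - y] by [y - x], so radius [delta] makes it
   admissible in the inner infimum. *)
move=> delta delta0; exists (U `&` [set x | `|y - x| < delta]%R).
  apply: filterI; first by apply: open_nbhs_nbhs.
  by apply: cvgr_dist_lt.
move=> x t [Uxx /= yx] fx /andP[t0 t1]; exists (xbar - x)%R.
  rewrite opprB addrC addrA subrK; exact: ltW.
have := fmono x t Uxx; rewrite ltW//= t1 => /(_ erefl) fle.
apply: mule_le0_ge0; first by rewrite leeBlDr// add0e.
by rewrite lee_fin invr_ge0 ltW.
Qed.
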